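(* Let $\mathcal{F}_{\mathrm{ass}}(\mathrm{ReLU})=\{x\mapsto Ax+b : A\in\mathbb{R}^{d\times d},\ b\in\mathbb{R}^d\}\cup\{\mathrm{ReLU},-\mathrm{ReLU}\}$, a family of vector fields on $\mathbb{R}^d$, where $\mathrm{ReLU}(x)=(\max(x_1,0),\dots,\max(x_d,0))$ for $x=(x_1,\dots,x_d)$. Then $\mathcal{F}_{\mathrm{ass}}(\mathrm{ReLU})$ achieves the UIP: for every positive integer $N$ and all data $(x_1,y_1),\dots,(x_N,y_N)\in\mathbb{R}^d\times\mathbb{R}^d$ with $x_i\neq x_j$ and $y_i\ne y_j$ for all $i\neq j$, there exists $\varphi\in\mathcal{H}(\mathcal{F}_{\mathrm{ass}}(\mathrm{ReLU}))$ such that $\varphi(x_i)=y_i$ for $i=1,\dots,N$. (When $d=1$, only data with $x_1<\cdots<x_N$ and $y_1<\cdots<y_N$ are considered.)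
   Context: For a Lipschitz vector field $v:\mathbb{R}^d\to\mathbb{R}^d$ and $\tau\ge 0$, the flow map $\phi_v^\tau$ sends $x_0$ to $x(\tau)$, where $\dot x(t)=v(x(t))$, $x(0)=x_0$. For a set (control family) $\mathcal{F}$ of such vector fields, $$\mathcal{H}(\mathcal{F})=\{\phi_{f_n}^{\tau_n}\circ\cdots\circ\phi_{f_1}^{\tau_1} : f_i\in\mathcal{F},\ \tau_i\ge 0,\ n\in\mathbb{N}\}.$$ *)

(* Defs.v *)
From mathcomp Require Import all_boot all_order all_algebra.
From mathcomp Require Import all_classical all_reals all_analysis.

Set Implicit Arguments.
Unset Strict Implicit.
Unset Printing Implicit Defensive.

Import Order.TTheory GRing.Theory Num.Theory.
Import numFieldNormedType.Exports.

Local Open Scope classical_set_scope.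
Local Open Scope ring_scope.

Definition vfield (R : realType) (d : nat) : Type := 'cV[R]_d -> 'cV[R]_d.

(* Since [v] is globally Lipschitz, the solution with a given initial value
   exists on the whole real line and is unique; [phi] is thus determined by
   [v] and [tau]. *)
Definition is_flow_map (R : realType) (d : nat) (v : vfield R d) (tau : R)
    (phi : 'cV[R]_d -> 'cV[R]_d) : Prop :=
  lipschitz v /\
  forall x0 : 'cV[R]_d, exists x : R -> 'cV[R]_d,
    [/\ x 0 = x0,
        forall t : R, is_derive t (1 : R) x (v (x t))
      & phi x0 = x tau].

(* The empty composition (n = 0) is the identity map. *)
Inductive hyp_space (R : realType) (d : nat) (F : set (vfield R d)) :
    ('cV[R]_d -> 'cV[R]_d) -> Prop :=
| hyp_space_id : hyp_space F id
| hyp_space_comp (f : vfield R d) (tau : R)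
    (phi psi : 'cV[R]_d -> 'cV[R]_d) :
    F f -> 0 <= tau -> is_flow_map f tau phi ->
    hyp_space F psi -> hyp_space F (phi \o psi).

Definition UIP (R : realType) (d : nat) (F : set (vfield R d)) : Prop :=
  forall (N : nat) (x y : 'I_N -> 'cV[R]_d),
    (0 < N)%N ->
    (forall i j : 'I_N, i != j -> x i != x j /\ y i != y j) ->
    (d = 1%N -> forall i j : 'I_N, (i < j)%N ->
       forall k : 'I_d, x i k 0 < x j k 0 /\ y i k 0 < y j k 0) ->
    exists phi : 'cV[R]_d -> 'cV[R]_d,
      hyp_space F phi /\ forall i : 'I_N, phi (x i) = y i.

Definition ReLU (R : realType) (d : nat) : vfield R d :=
  fun x => \col_(k < d) Num.max (x k 0) 0.

Definition F_ass (R : realType) (d : nat) (h : vfield R d) :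
    set (vfield R d) :=
  [set f | exists (A : 'M[R]_d) (b : 'cV[R]_d), f = (fun x => A *m x + b)]
  `|` [set h; (fun x => - h x)].

(* Main.v *)
Require Import Defs.
From mathcomp Require Import all_boot all_order all_algebra.
From mathcomp Require Import all_classical all_reals all_analysis.
From mathcomp Require Import ring lra.

Set Implicit Arguments.
Unset Strict Implicit.
Unset Printing Implicit Defensive.

Import Order.TTheory GRing.Theory Num.Theory.
Import numFieldNormedType.Exports.

Local Open Scope classical_set_scope.
Local Open Scope ring_scope.

(** The whole construction moves one finite configuration of points to another
    ([reach]) by composing two kinds of explicit flows: the time-one flow
    [v |-> v + (A v + b)] of an affine field with [A (A v + b) = 0], which
    yields the translations and the shears, and the flow
    [v |-> v + (r - 1) ReLU v], [r > 0], of [ReLU] (for [r >= 1]) or [- ReLU]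
    (for [r <= 1]).

    Along one coordinate [k], every order-preserving change of values is
    possible while the other coordinates are kept ([reach_interpolation]).
    Only finitely many points matter, so a translation can make all their
    other coordinates nonpositive, where [ReLU] vanishes; the flow of [ReLU]
    then stretches the part of the [k]-axis above a chosen threshold
    ([reach_above]).  Stretching above increasing thresholds puts the values
    in their final places one after the other.  This settles dimension one.

    In higher dimension, let the [k]-coordinates of the points be pairwise
    distinct.  Shearing coordinate [l] by [- c] times coordinate [k], changing
    the [k]-coordinates by [g i / c], shearing back by [c], and restoring the
    [k]-coordinates adds [g i] to the [l]-coordinate of point [i]
    ([reach_other_coord]).  For [c] large, the change by [g i / c] preserves
    the order, whatever [g] is.  So any two configurations that share the same,
    pairwise distinct, [k]-coordinates can be joined ([reach_same_coord]).

    Finally a generic shear makes the first coordinates of the sources pairwise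
    distinct, and another one the second coordinates of the targets
    ([generic_shear]).  The configuration that takes its first coordinates from
    the sheared sources and the other ones from the sheared targets can be
    joined to both. *)

(** * Explicit flows *)

Section Flows.
Variables (R : realType) (d : nat).
Implicit Types (u v x : 'cV[R]_d) (A : 'M[R]_d).

Lemma coord_le_norm x (k : 'I_d) : `|x k 0| <= `|x|.
Proof.
rewrite [leRHS]/Num.Def.normr/= mx_normrE.
exact: (le_bigmax _ (fun ij : 'I_d * 'I_1 => `|x ij.1 ij.2|) (k, 0)).
Qed.

(** The norm on column vectors is the maximum norm, so Lipschitz bounds can be
    checked coordinate by coordinate. *)
Lemma coord_lipschitz (f : vfield R d) (L : R) : 0 <= L ->
  (forall x y k, `|f x k 0 - f y k 0| <= L * `|x - y|) -> lipschitz f.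
Proof.
move=> L0 fL; apply: (@klipschitzW _ _ _ L) => [|[x y] _ /=].
  by apply: (@globally_properfilter _ _ (0, 0)).
rewrite [leLHS]/Num.Def.normr/= mx_normrE.
apply: bigmax_le => [|[k j] _]; first by rewrite mulr_ge0.
by rewrite /= !mxE (ord1 j).
Qed.

Lemma lipschitz_affine A u : lipschitz (fun x => A *m x + u).
Proof.
apply: (@coord_lipschitz _ (\sum_k \sum_l `|A k l|)) => [|x y k].
  by rewrite sumr_ge0// => k _; rewrite sumr_ge0.
have -> : (A *m x + u) k 0 - (A *m y + u) k 0 = \sum_l A k l * (x - y) l 0.
  have -> : (A *m x + u) k 0 - (A *m y + u) k 0 = (A *m (x - y)) k 0.
    by rewrite mulmxBr !mxE; ring.
  by rewrite mxE.
apply: le_trans (ler_norm_sum _ _ _) _.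
apply: (@le_trans _ _ (\sum_l `|A k l| * `|x - y|)).
  by apply: ler_sum => l _; rewrite normrM ler_wpM2l// coord_le_norm.
rewrite -mulr_suml ler_wpM2r//.
by rewrite [leRHS](bigD1 k)//= lerDl sumr_ge0// => i _; rewrite sumr_ge0.
Qed.

Lemma lipschitz_ReLU (s : R) : lipschitz (fun x => s *: ReLU x).
Proof.
apply: (@coord_lipschitz _ `|s|) => // x y k.
rewrite !mxE -mulrBr normrM ler_wpM2l//.
apply: le_trans (coord_le_norm (x - y) k); rewrite !mxE.
move: (x k 0) (y k 0) => a b.
have h1 := ler_norm (a - b); have h2 := ler_norm (b - a).
rewrite ler_norml; move: h1 h2; rewrite (distrC b a) => h1 h2.
by case: (leP a 0) => ha; case: (leP b 0) => hb; apply/andP; split; lra.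
Qed.

(** All trajectories used below stay on a line and differ only in the speed
    along it. *)
Lemma is_derive_ray (f : R -> R) (df t : R) u v :
  is_derive t 1 f df -> is_derive t 1 (fun s => u + f s *: v) (df *: v).
Proof.
move=> fdf.
have coordE i j : (fun s => (u + f s *: v) i j) = cst (u i j) + (v i j) \*: f.
  by apply/funext => s; rewrite !mxE/= mulrC.
have D i j : is_derive t 1 (fun s => (u + f s *: v) i j) (v i j * df).
  by rewrite coordE; apply: is_derive_eq; rewrite add0r.
have Dm : derivable (fun s => u + f s *: v) t 1.
  by apply/derivable_mxP => i j; exact: (ex_derive (is_derive := D i j)).
apply: DeriveDef => //; rewrite derive_mx//; apply/matrixP => i j.
by rewrite !mxE derive_val mulrC.
Qed.

(** Under the hypothesis the velocity [A x + u] is constant along trajectories,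
    which are therefore uniform straight motions. *)
Lemma affine_flow_map A u : (forall x, A *m (A *m x + u) = 0) ->
  is_flow_map (fun x => A *m x + u) 1 (fun x => x + (A *m x + u)).
Proof.
move=> A0; split=> [|x0]; first exact: lipschitz_affine.
exists (fun t => x0 + t *: (A *m x0 + u)); split=> [|t|].
- by rewrite scale0r addr0.
- rewrite [X in is_derive _ _ _ X](_ : _ = 1 *: (A *m x0 + u)).
    exact: is_derive_ray.
  by rewrite mulmxDr -scalemxAr A0 scaler0 addr0 scale1r.
- by rewrite scale1r.
Qed.

(** Positive coordinates are scaled by [expR (s * t)] and the others stand still.
    Both are summed up by the displacement along [ReLU x], because signs are
    preserved and so [ReLU] of the trajectory is [expR (s * t) *: ReLU x]. *)
Lemma ReLU_flow_map (s tau : R) :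
  is_flow_map (fun x => s *: ReLU x) tau
    (fun x => x + (expR (s * tau) - 1) *: ReLU x).
Proof.
split=> [|x0]; first exact: lipschitz_ReLU.
exists (fun t => x0 + (expR (s * t) - 1) *: ReLU x0); split=> [|t|//].
  by rewrite mulr0 expR0 subrr scale0r addr0.
rewrite [X in is_derive _ _ _ X](_ : _ = (s * expR (s * t)) *: ReLU x0).
  apply: is_derive_ray.
  have -> : (fun t => expR (s * t) - 1) = expR \o (s \*: id) - cst 1.
    by apply/funext => r.
  by apply: is_derive_eq; rewrite subr0 [_ *: 1]mulr1 mulrC.
rewrite -scalerA; congr (_ *: _); apply/matrixP => i j; rewrite !mxE.
have e0 := expR_gt0 (s * t); rewrite /Num.max.
case: (ltP (x0 i 0)) => h1; case: ltP => h2; nra.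
Qed.
End Flows.

(** * Moving configurations of points *)

Lemma hyp_space_compose (R : realType) (d : nat) (F : set (vfield R d)) f g :
  hyp_space F f -> hyp_space F g -> hyp_space F (f \o g).
Proof.
move=> Ff Fg; elim: Ff => [//|h tau phi psi Fh tau0 hphi _ IH].
exact: (hyp_space_comp Fh tau0 hphi IH).
Qed.

(** The product of the polynomials has fewer roots than its size, so one of the
    integers [0, ..., size q - 1] is not a root. *)
Lemma common_nonroot (F : numDomainType) (ps : seq {poly F}) :
  all (fun p => p != 0) ps ->
  exists2 t, t != 0 & all (fun p : {poly F} => p.[t] != 0) ps.
Proof.
move=> ps0; (* The factor ['X] makes the nonroots of [q] nonzero. *)
pose q := 'X * \prod_(p <- ps) p.
have q0 : q != 0.
  rewrite mulf_neq0 ?polyX_eq0//; elim: ps ps0 {q} => [|p s IH] /=.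
    by rewrite big_nil oner_neq0.
  by case/andP=> p0 /IH s0; rewrite big_cons mulf_neq0.
pose rs := [seq n%:R : F | n <- iota 0 (size q)].
have /allPn[t _ /negbTE tq] : ~~ all (root q) rs.
  apply/negP => qr; have := max_poly_roots q0 qr.
  rewrite size_map size_iota ltnn => /(_ _)/notF; apply.
  by rewrite map_inj_uniq ?iota_uniq// => m n /eqP; rewrite eqr_nat => /eqP.
exists t.
  by apply: contraFneq tq => ->; rewrite /q rootM rootX eqxx.
apply/allP => p pin; apply: contraFneq tq => pt0.
rewrite /q rootM; apply/orP; right; rewrite (big_rem p)//= rootM.
by rewrite [root p t]/root pt0 eqxx.
Qed.

Section Reach.
Variables (R : realType) (d : nat) (I : finType).
Implicit Types (x y z : I -> 'cV[R]_d) (A : 'M[R]_d) (u : 'cV[R]_d).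

Definition reach x y := exists phi : 'cV[R]_d -> 'cV[R]_d,
  hyp_space (F_ass (@ReLU R d)) phi /\ forall i, phi (x i) = y i.

Lemma reach_trans y x z : reach x y -> reach y z -> reach x z.
Proof.
move=> [f [Ff fE]] [g [Fg gE]]; exists (g \o f).
by split=> [|i]; [exact: hyp_space_compose|rewrite /= fE].
Qed.

Lemma reach_eq x y : (forall i, x i = y i) -> reach x y.
Proof. by move=> xy; exists id; split=> //; exact: hyp_space_id. Qed.

Lemma reach_flow (f : vfield R d) tau phi x : F_ass (@ReLU R d) f -> 0 <= tau ->
  is_flow_map f tau phi -> reach x (fun i => phi (x i)).
Proof.
move=> Ff tau0 fphi; exists (phi \o id); split=> //.
exact: hyp_space_comp Ff tau0 fphi (hyp_space_id _).
Qed.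

Lemma reach_translation u x : reach x (fun i => x i + u).
Proof.
have F0 : F_ass (@ReLU R d) (fun v => 0 *m v + u) by left; exists 0, u.
have fl : is_flow_map (fun v => 0 *m v + u) 1 (fun v => v + (0 *m v + u)).
  by apply: affine_flow_map => v; rewrite mul0mx.
apply: reach_trans (reach_flow x F0 ler01 fl) _.
by apply: reach_eq => i; rewrite mul0mx add0r.
Qed.

Lemma reach_linear A x : A *m A = 0 -> reach x (fun i => x i + A *m x i).
Proof.
move=> A0.
have FA : F_ass (@ReLU R d) (fun v => A *m v + 0) by left; exists A, 0.
have fl : is_flow_map (fun v => A *m v + 0) 1 (fun v => v + (A *m v + 0)).
  by apply: affine_flow_map => v; rewrite addr0 mulmxA A0 mul0mx.
apply: reach_trans (reach_flow x FA ler01 fl) _.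
by apply: reach_eq => i; rewrite addr0.
Qed.

(** The sign in front of [ReLU] decides between dilation and contraction; the
    flow time is [`|ln r|]. *)
Lemma reach_ReLU (r : R) x : 0 < r ->
  reach x (fun i => x i + (r - 1) *: ReLU (x i)).
Proof.
move=> r0; have rE : expR (ln r) = r by rewrite lnK.
have [r1|r1] := leP 1 r.
- have F1 : F_ass (@ReLU R d) (fun v => 1 *: ReLU v).
    by right; left; apply/funext => v; rewrite scale1r.
  have := reach_flow x F1 (ln_ge0 r1) (ReLU_flow_map _ _ _).
  by rewrite mul1r rE.
- have F1 : F_ass (@ReLU R d) (fun v => -1 *: ReLU v).
    by right; right; apply/funext => v; rewrite scaleN1r.
  have tau0 : 0 <= - ln r by rewrite oppr_ge0 ln_le0// ltW.
  have := reach_flow x F1 tau0 (ReLU_flow_map _ _ _).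
  by rewrite mulrNN mul1r rE.
Qed.

(** * Order-preserving moves along one coordinate *)

Notation e_ k := (delta_mx k 0 : 'cV[R]_d).

Lemma delta_coord (k l : 'I_d) : e_ k l 0 = (l == k)%:R.
Proof. by rewrite mxE eqxx andbT. Qed.

(** Translating coordinate [k] by [- c] puts the threshold at the kink of
    [ReLU], and translating the others far to the left freezes them during the
    flow. *)
Lemma reach_above (k : 'I_d) (c r : R) x : 0 < r ->
  reach x (fun i => x i + ((r - 1) * Num.max (x i k 0 - c) 0) *: e_ k).
Proof.
move=> r0.
pose M := \sum_i \sum_l `|x i l 0|.
pose u : 'cV[R]_d := \col_l (if l == k then - c else - M).
apply: reach_trans (reach_translation u x) _.
apply: reach_trans (reach_ReLU _ r0) _.
apply: reach_trans (reach_translation (- u) _) _.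
apply: reach_eq => i; apply/matrixP => l j; rewrite (ord1 j).
rewrite ![in LHS]mxE ![in RHS]mxE eqxx andbT.
case: eqVneq => [->|lk]; first by rewrite /=; ring.
suff : x i l 0 - M <= 0 by move/max_r ->; rewrite /=; ring.
rewrite subr_le0 (le_trans (ler_norm _))// /M.
rewrite (bigD1 i)//= (bigD1 l)//= -addrA lerDl addr_ge0 ?sumr_ge0// => ? _.
by rewrite sumr_ge0.
Qed.

(** Induction on the number of points that are not yet settled at their target.
    The settled points [A] always lie below the others, so stretching above a
    threshold that bounds [A] leaves [A] alone, keeps the order, and with the
    right factor settles the lowest of the other points. *)
Lemma reach_interpolation (k : 'I_d) (t : I -> R) x :
  (forall i j, i != j -> x i k 0 != x j k 0) ->
  (forall i j, x i k 0 < x j k 0 -> t i < t j) ->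
  reach x (fun i => x i + (t i - x i k 0) *: e_ k).
Proof.
move=> xI xt.
suff H (n : nat) (A : {set I}) : #|~: A| = n -> forall x,
  (forall i j, i != j -> x i k 0 != x j k 0) ->
  (forall i j, x i k 0 < x j k 0 -> t i < t j) ->
  (forall a, a \in A -> x a k 0 = t a) ->
  (forall a i, a \in A -> i \notin A -> x a k 0 < x i k 0) ->
  reach x (fun i => x i + (t i - x i k 0) *: e_ k).
  by apply: (H _ finset.set0 (erefl _) x) => // a; rewrite inE.
elim: n A => [|n IH] A cA {xI xt} {}x xI xt xA xAC.
  apply: reach_eq => i; rewrite xA ?subrr ?scale0r ?addr0//.
  by move: (cards0_eq cA) => /setP/(_ i); rewrite !inE => /negbFE.
have [m0 m0A] : exists m, m \in ~: A by apply/set0Pn; rewrite -cards_eq0 cA.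
pose m := [arg min_(i < m0 | i \in ~: A) x i k 0]%O.
have [mA mmin] : m \notin A /\ forall i, i \notin A -> x m k 0 <= x i k 0.
  rewrite /m; case: arg_minP => // i iA imin.
  by split=> [|j jA]; [rewrite inE in iA|apply: imin; rewrite inE].
(* The threshold must be at least every settled value and below both the
   current and the target value of [m]; the default value of the maximum
   serves when [A] is empty. *)
pose c := \big[Num.max/Num.min (x m k 0) (t m) - 1]_(a in A) t a.
have cx : c < x m k 0.
  apply: bigmax_lt => [|a aA]; first by rewrite ltrBlDr ltr_pwDr// ge_min lexx.
  by rewrite -xA// xAC.
have ct : c < t m.
  apply: bigmax_lt => [|a aA].
    by rewrite ltrBlDr ltr_pwDr// ge_min lexx orbT.
  by rewrite xt// xAC.
have le_c a : a \in A -> x a k 0 <= c.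
  by move=> aA; rewrite xA//; apply: le_bigmax_cond.
pose r := (t m - c) / (x m k 0 - c).
have r0 : 0 < r by rewrite divr_gt0 ?subr_gt0.
apply: reach_trans (reach_above k c x r0) _.
set x' := fun i => _.
have x'k i : x' i k 0 = x i k 0 + (r - 1) * Num.max (x i k 0 - c) 0.
  by rewrite !mxE !eqxx mulr1.
have x'mono i j : x i k 0 < x j k 0 -> x' i k 0 < x' j k 0.
  rewrite !x'k; case: (leP (x i k 0 - c) 0); case: (leP (x j k 0 - c) 0); nra.
have x'I i j : x' i k 0 < x' j k 0 -> x i k 0 < x j k 0.
  case: (ltgtP (x i k 0) (x j k 0)) => [//|/x'mono h h'|].
    by move: (lt_trans h h'); rewrite ltxx.
  by rewrite !x'k => ->; rewrite ltxx.
have x'A a : a \in A -> x' a k 0 = t a.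
  move=> aA; rewrite x'k max_r ?mulr0 ?addr0 ?xA// subr_le0 -xA//.
  exact: le_c.
have x'm : x' m k 0 = t m.
  rewrite x'k max_l ?subr_ge0 ?ltW// /r.
  by field; rewrite subr_eq0 gt_eqF.
have : reach x' (fun i => x' i + (t i - x' i k 0) *: e_ k).
  apply: (IH (m |: A)) => [|i j ij|i j /x'I/xt//|a /setU1P[->//|/x'A//]|a i].
  - move: cA; rewrite (cardsD1 m) inE mA add1n => -[<-].
    by apply: eq_card => i; rewrite !inE negb_or.
  - have := xI _ _ ij; rewrite neq_lt => /orP[]/x'mono h.
      by rewrite lt_eqF.
    by rewrite gt_eqF.
  - move=> aA; rewrite in_setU1 negb_or => /andP[im iA].
    apply: x'mono; case/setU1P: aA => [->|aA]; last exact: xAC.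
    by rewrite lt_neqAle mmin// andbT xI// eq_sym.
move/reach_trans; apply; apply: reach_eq => i.
by rewrite x'k /x' -addrA -scalerDl; congr (_ + _ *: _); ring.
Qed.

(** * Arbitrary moves along the other coordinates *)

Lemma reach_shear (k l : 'I_d) (c : R) x : k != l ->
  reach x (fun i => x i + (c * x i k 0) *: e_ l).
Proof.
move=> kl; have A0 : (c *: delta_mx l k : 'M[R]_d) *m (c *: delta_mx l k) = 0.
  by rewrite -scalemxAl -scalemxAr mul_delta_mx_0 ?scaler0// .
apply: reach_trans (reach_linear x A0) _; apply: reach_eq => i; congr (_ + _).
apply/matrixP => a b; rewrite (ord1 b) !mxE (bigD1 k)//= big1 => [|j jk].
  by rewrite !mxE !eqxx andbT addr0; ring.
by rewrite !mxE (negbTE jk) andbF mulr0 mul0r.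
Qed.

(** The commutator of a shear of [l] along [k] with an order-preserving change
    of coordinate [k] moves coordinate [l] only, and with no constraint on the
    order: a large shear factor [c] amplifies a change of the [k]-coordinates
    that is too small to disturb their order. *)
Lemma reach_other_coord (k l : 'I_d) (g : I -> R) x : k != l ->
  (forall i j, i != j -> x i k 0 != x j k 0) ->
  reach x (fun i => x i + g i *: e_ l).
Proof.
move=> kl xI.
(* [c] exceeds every quotient of a difference of [g] by the corresponding
   difference of [k]-coordinates; the quotients with zero denominator are zero
   and harmless. *)
pose c := 1 + \sum_i \sum_j `|(g i - g j) / (x j k 0 - x i k 0)|.
have c0 : 0 < c.
  by rewrite ltr_pwDl// sumr_ge0// => i _; rewrite sumr_ge0.
have cg i j : x i k 0 < x j k 0 -> x i k 0 + g i / c < x j k 0 + g j / c.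
  move=> xij; suff : (g i - g j) / c < x j k 0 - x i k 0 by rewrite mulrBl; lra.
  rewrite ltr_pdivrMr// mulrC -ltr_pdivrMr ?subr_gt0//.
  apply: le_lt_trans (ler_norm _) _.
  rewrite /c ltr_pwDl// (bigD1 i)//= (bigD1 j)//= -addrA lerDl.
  by rewrite addr_ge0 ?sumr_ge0// => a _; rewrite sumr_ge0.
have cn := gt_eqF c0.
have xkl (y : 'cV[R]_d) b : (y + b *: e_ l) k 0 = y k 0.
  by rewrite !mxE (negbTE kl) mulr0 addr0.
have xkk (y : 'cV[R]_d) b : (y + b *: e_ k) k 0 = y k 0 + b.
  by rewrite !mxE !eqxx mulr1.
apply: reach_trans (reach_shear (- c) x kl) _.
apply: reach_trans
  (@reach_interpolation k (fun i => x i k 0 + g i / c) _ _ _) _.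
- by move=> i j; rewrite !xkl; exact: xI.
- by move=> i j; rewrite !xkl; exact: cg.
apply: reach_trans (reach_shear c _ kl) _.
apply: reach_trans (@reach_interpolation k (fun i => x i k 0) _ _ _) _.
- move=> i j /xI; rewrite neq_lt => /orP[] /cg h; rewrite !(xkl, xkk).
    by rewrite lt_eqF//; lra.
  by rewrite gt_eqF//; lra.
- move=> i j; rewrite !(xkl, xkk) => h; rewrite ltNge le_eqVlt negb_or.
  apply/andP; split; last by apply/negP => /cg; lra.
  apply/negP => /eqP.
  have [ij _|/xI/[swap] ->] := eqVneq i j; last by rewrite eqxx.
  by move: h; rewrite ij ltxx.
apply: reach_eq => i; rewrite !(xkl, xkk).
apply/matrixP => a b; rewrite (ord1 b) !mxE.
by field; rewrite cn.
Qed.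

(** The coordinates other than [k] are corrected one at a time; the
    [k]-coordinates stay distinct all along. *)
Lemma reach_same_coord (k : 'I_d) x y :
  (forall i j, i != j -> x i k 0 != x j k 0) ->
  (forall i, x i k 0 = y i k 0) -> reach x y.
Proof.
move=> xI xy.
have H (s : seq 'I_d) : all (predC1 k) s ->
    reach x (fun i => x i + \sum_(l <- s) (y i l 0 - x i l 0) *: e_ l).
  elim/last_ind: s => [_|s l IH].
    by apply: reach_eq => i; rewrite big_nil addr0.
  rewrite all_rcons => /andP[/= lk sk]; apply: reach_trans (IH sk) _.
  have zk i : (x i + \sum_(l <- s) (y i l 0 - x i l 0) *: e_ l) k 0 = x i k 0.
    rewrite mxE summxE big_seq big1 ?addr0// => j js; rewrite !mxE.
    by rewrite eq_sym (negbTE (allP sk _ js)) mulr0.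
  apply: reach_trans (@reach_other_coord k l
    (fun i => y i l 0 - x i l 0) _ _ _) _.
  - by rewrite eq_sym.
  - by move=> i j ij; rewrite !zk xI.
  by apply: reach_eq => i; rewrite -cats1 big_cat big_seq1 addrA.
have := H [seq l <- enum 'I_d | l != k] (filter_all _ _).
move/reach_trans; apply; apply: reach_eq => i.
rewrite big_filter big_enum_cond /=; apply/matrixP => l j; rewrite (ord1 j).
rewrite mxE summxE; case: (eqVneq l k) => [->|lk].
  rewrite big1 ?addr0// => m mk; rewrite !mxE.
  by rewrite eq_sym (negbTE mk) mulr0.
rewrite (bigD1 l)//= big1 => [|m /andP[_ ml]]; rewrite !mxE.
  by rewrite !eqxx mulr1 addr0 subrKC.
by rewrite eq_sym (negbTE ml) mulr0.
Qed.

(** * Separating the coordinates *)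

(** The shear adds to coordinate [k] a combination of the other coordinates with
    weights [t ^+ l / t ^+ k], so that the new [k]-coordinate of a vector [v] is
    [(\sum_l v l 0 * t ^+ l) / t ^+ k].  For [v] a difference of two points this
    is a nonzero polynomial in [t] divided by [t ^+ k], and [t] is chosen off
    the finitely many roots.  The weight of [k] in [w] is zero to make [A]
    square to zero, which also makes the shear by [- A] its inverse. *)
Lemma generic_shear (k : 'I_d) x : (forall i j, i != j -> x i != x j) ->
  exists x', [/\ reach x x', reach x' x &
                 forall i j, i != j -> x' i k 0 != x' j k 0].
Proof.
move=> xI.
pose p (v : 'cV[R]_d) := rVpoly v^T.
have [t t0 tP] : exists2 t, t != 0 &
    forall i j, i != j -> (p (x i - x j)).[t] != 0.
  have [|t t0 /allP tP] := @common_nonroot R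
    [seq p (x ij.1 - x ij.2) | ij <- enum {: I * I} & ij.1 != ij.2].
    apply/allP => q /mapP[[i j]] /=; rewrite mem_filter => /andP[/= ij _] ->.
    apply: contraNneq (xI _ _ ij) => pq; rewrite -subr_eq0 -trmx_eq0.
    by rewrite -(rVpolyK (x i - x j)^T) -/(p _) pq linear0.
  exists t => // i j ij; apply: tP; apply/mapP; exists (i, j) => //.
  by rewrite mem_filter ij mem_enum.
pose w : 'rV[R]_d := \row_l (if l == k then 0 else t ^+ l / t ^+ k).
pose A := e_ k *m w.
have Ak v : (A *m v) k 0 + v k 0 = (p v).[t] / t ^+ k.
  rewrite /A -mulmxA mxE big_ord1 delta_coord eqxx mul1r mxE (bigD1 k)//=.
  rewrite mxE eqxx mul0r add0r horner_poly mulr_suml [RHS](bigD1 k)//= addrC.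
  rewrite valK mxE mulfK ?expf_neq0//; congr (_ + _); apply: eq_bigr => l lk.
  by rewrite mxE (negbTE lk) valK mxE; ring.
have A0 : A *m A = 0.
  rewrite /A mulmxA -(mulmxA _ w) [w *m _](_ : _ = 0) ?mulmx0 ?mul0mx//.
  by rewrite -colE; apply/matrixP => a b; rewrite !mxE eqxx.
exists (fun i => x i + A *m x i); split; first exact: reach_linear.
- have NA0 : (- A) *m (- A) = 0 by rewrite mulNmx mulmxN A0 !oppr0.
  apply: reach_trans (reach_linear _ NA0) _; apply: reach_eq => i.
  by rewrite mulNmx mulmxDr mulmxA A0 mul0mx addr0 addrK.
- move=> i j ij; rewrite -subr_eq0.
  have -> : (x i + A *m x i) k 0 - (x j + A *m x j) k 0 =
      (A *m (x i - x j)) k 0 + (x i - x j) k 0.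
    by rewrite mulmxBr !mxE; ring.
  by rewrite Ak mulf_neq0 ?tP// invr_neq0// expf_neq0.
Qed.
End Reach.

(** * Interpolation *)

Theorem corollary2p12 (R : realType) (d : nat) (hd : (0 < d)%N) :
  UIP (F_ass (@ReLU R d)).
Proof.
move=> N x y _ xyI xy1; change (reach x y).
have xI i j : i != j -> x i != x j by case/xyI.
have yI i j : i != j -> y i != y j by case/xyI.
have [d1|d1] := leqP d 1.
  have {}d1 : d = 1%N by apply/eqP; rewrite eqn_leq d1.
  subst d.
  have xyP (i j : 'I_N) k : (i < j)%N -> x i k 0 < x j k 0 /\ y i k 0 < y j k 0.
    by move=> ij; exact: xy1.
  apply: reach_trans
    (@reach_interpolation _ _ _ ord0 (fun i => y i 0 0) _ _ _) _.
  - by move=> i j; rewrite neq_ltn => /orP[] /xyP-/(_ ord0)[h _];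
      rewrite ?(lt_eqF h)// (gt_eqF h).
  - move=> i j; case: (ltngtP i j).
    + by move=> /xyP-/(_ ord0)[].
    + by move=> /xyP-/(_ ord0)[h _] h'; move: (lt_trans h h'); rewrite ltxx.
    + by move/val_inj ->; rewrite ltxx.
  apply: reach_eq => i; apply/matrixP => a b.
  by rewrite (ord1 a) (ord1 b) !mxE !eqxx mulr1 subrKC.
pose k1 := Ordinal hd; pose k2 := Ordinal d1.
have [x' [xx' _ x'I]] := generic_shear k1 xI.
have [y' [_ y'y y'I]] := generic_shear k2 yI.
pose z i := y' i + (x' i k1 0 - y' i k1 0) *: delta_mx k1 0.
have zk1 i : x' i k1 0 = z i k1 0 by rewrite !mxE !eqxx mulr1 subrKC.
have zk2 i : z i k2 0 = y' i k2 0 by rewrite !mxE /= mulr0 addr0.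
apply: reach_trans xx' _; apply: reach_trans (reach_same_coord x'I zk1) _.
apply: reach_trans (reach_same_coord _ zk2) y'y.
by move=> i j ij; rewrite !zk2 y'I.
Qed.
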